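(* Let $G$ be a finitely generated group with undecidable domino problem. Every computable real-valued dynamical invariant for $G$-SFTs that is nondecreasing by disjoint unions and by direct products with nonempty systems is constant. That is: let $\mathcal{I}$ be a real-valued dynamical invariant for $G$-SFTs which is computable from presentations and such that $\mathcal{I}(X\sqcup Y)\geq \mathcal{I}(X)$ for all $G$-SFTs $X,Y$, and $\mathcal{I}(X\times Y)\geq\mathcal{I}(X)$ for every $G$-SFT $X$ and every nonempty $G$-SFT $Y$. Then $\mathcal{I}$ takes the same value on all $G$-SFTs.
   Context: Let $G$ be a finitely generated group and fix a finite symmetric generating set $S$ of $G$. For a word $w\in S^{*}$, $\underline{w}\in G$ denotes the corresponding group element. Subshifts. For a finite alphabet $A$, $A^G=\{x\colon G\to A\}$ carries the prodiscrete topology and the shift action $(gx)(h)=x(g^{-1}h)$. A subshift is a closed shift-invariant subset of $A^G$; the empty set is allowed. A morphism of subshifts is a continuous map commuting with the shift action; a conjugacy is a bijective morphism. SFT presentations. A pattern presentation is a function $p\colon W\to A$ with $W\subset S^{*}$ finite and $A\subset\mathbb{N}$ a finite alphabet. It appears in $x\in A^G$ at $g\in G$ when $x(g\underline{w})=p(w)$ for every $w\in W$. An SFT presentation is a pair $(A,\mathcal{F})$ with $A\subset\mathbb{N}$ a finite alphabet and $\mathcal{F}$ a finite set of pattern presentations $p\colon W\to A$. It determines the subshift $X_{(A,\mathcal{F})}\subset A^G$ of all configurations in which no element of $\mathcal{F}$ appears (at any $g\in G$). Subshifts of this form are called $G$-SFTs; the empty subshift is a $G$-SFT. The domino problem of $G$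 is the set $\operatorname{DP}(G)$ of all SFT presentations $(A,\mathcal{F})$ such that $X_{(A,\mathcal{F})}=\emptyset$; $G$ has undecidable domino problem if this set is not decidable. A real-valued dynamical invariant $\mathcal{I}$ for $G$-SFTs assigns a real number $\mathcal{I}(X)$ to every $G$-SFT $X$ (including the empty one), with conjugate $G$-SFTs receiving the same value. It is computable from presentations when there is an algorithm which, given a presentation of a $G$-SFT $X$ and a desired precision, outputs a rational approximation to $\mathcal{I}(X)$ with that precision. The direct product $X\times Y$ (with the diagonal action) and the disjoint union $X\sqcup Y$ of two $G$-SFTs are topological dynamical systems that are conjugate (via equivariant homeomorphisms) to $G$-SFTs, and $\mathcal{I}(X\times Y)$, $\mathcal{I}(X\sqcup Y)$ mean the value of $\mathcal{I}$ on any such conjugate $G$-SFT. *)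

(* Defs.v *)
From HB Require Import structures.
From mathcomp Require Import all_boot all_order all_algebra.
From mathcomp Require Import all_classical all_reals all_analysis.

Set Implicit Arguments.
Unset Strict Implicit.
Unset Printing Implicit Defensive.

Import Order.TTheory GRing.Theory Num.Theory.

Local Open Scope classical_set_scope.

(** * Partial recursive functions *)

(* Kleene's mu-recursive function expressions.  Arities are not tracked by the
   types: an expression is applied to a list of arguments, and [RProj i] reads
   a missing argument as 0. *)
Inductive rfun : Type :=
| RZero
| RSucc
| RProj of nat
| RComp of rfun & seq rfun
| RRec of rfun & rfun
| RMin of rfun.

(* [reval f v z]: the computation of [f] on the arguments [v] halts with
   value [z]. *)
Inductive reval : rfun -> seq nat -> nat -> Prop :=
| reval_zero v : reval RZero v 0
| reval_succ v : reval RSucc v (nth 0 v 0).+1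
| reval_proj i v : reval (RProj i) v (nth 0 v i)
| reval_comp f gs v ws z :
    revals gs v ws -> reval f ws z -> reval (RComp f gs) v z
| reval_rec0 f g v z : reval f v z -> reval (RRec f g) (0 :: v) z
| reval_recS f g n v y z :
    reval (RRec f g) (n :: v) y -> reval g (n :: y :: v) z ->
    reval (RRec f g) (n.+1 :: v) z
| reval_min f v n :
    (forall i, i < n -> exists k, reval f (i :: v) k.+1) ->
    reval f (n :: v) 0 -> reval (RMin f) v n
with revals : seq rfun -> seq nat -> seq nat -> Prop :=
| revals_nil v : revals [::] v [::]
| revals_cons g gs v w ws :
    reval g v w -> revals gs v ws -> revals (g :: gs) v (w :: ws).

(** * Groups and words *)

Section Words.
Variables (G : groupType) (n : nat) (S : n.-tuple G).

Definition word_elt (w : seq 'I_n) : G := (\prod_(i <- w) tnth S i)%g.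

Definition symmetric_generating_set : Prop :=
  [/\ uniq S,
      (forall s, s \in S -> (s^-1)%g \in S)
    & forall g : G, exists w : seq 'I_n, word_elt w = g].

End Words.

(** * Presentations *)

(* A word over an [n]-element generating set is a list of indices of generators.
   Finite sets are represented by lists.  A pattern presentation W -> A is the
   list of the pairs (w, p w), hence the uniqueness condition on first
   components below. *)
Definition pattern (n : nat) : Type := seq (seq 'I_n * nat).

Definition is_pattern (n : nat) (A : seq nat) (p : pattern n) : bool :=
  uniq (unzip1 p) && all (fun a => a \in A) (unzip2 p).

Record presentation (n : nat) : Type := Presentation {
  pres_data :> seq nat * seq (pattern n);
  _ : all (is_pattern pres_data.1) pres_data.2
}.

HB.instance Definition _ n := [isSub for @pres_data n].
HB.instance Definition _ n := [Countable of presentation n by <:].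

Definition alphabet n (P : presentation n) : seq nat := (pres_data P).1.
Definition forbidden n (P : presentation n) : seq (pattern n) := (pres_data P).2.

(** * Configurations and subshifts of finite type *)

(* Configurations over all finite alphabets A of natural numbers live in
   nat^G; the prodiscrete topology of A^G is the subspace topology. *)
Definition config (G : Type) : topologicalType := {ptws G -> nat}.

Definition gshift (G : groupType) (g : G) (x : config G) : config G :=
  fun h => x (g^-1 * h)%g.

Section SFT.
Variables (G : groupType) (n : nat) (S : n.-tuple G).

Definition appears (p : pattern n) (x : config G) (g : G) : Prop :=
  forall w a, (w, a) \in p -> x (g * word_elt S w)%g = a.

Definition sft (P : presentation n) : set (config G) :=
  [set x | (forall g, x g \in alphabet P) /\
           (forall p, p \in forbidden P -> forall g, ~ appears p x g)].

Definition is_sft (X : set (config G)) : Prop := exists P, X = sft P.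

Definition domino_problem : set (presentation n) := [set P | sft P = set0].

(* [pickle] computes to the explicit Goedel numbering of lists of [CodeSeq];
   presentations are numbered through their data. *)
Definition domino_decidable : Prop :=
  exists f : rfun, forall P : presentation n,
    (domino_problem P -> reval f [:: pickle P] 1) /\
    (~ domino_problem P -> reval f [:: pickle P] 0).

End SFT.

(** * Morphisms and conjugacies *)

Definition morphism (G : groupType) (X Y : set (config G))
    (f : config G -> config G) : Prop :=
  [/\ set_fun X Y f, {within X, continuous f}
    & forall g x, X x -> f (gshift g x) = gshift g (f x)].

Definition conjugate (G : groupType) (X Y : set (config G)) : Prop :=
  exists f, morphism X Y f /\ set_bij X Y f.

(* Equivariant homeomorphism between invariant subsets [X] and [Y] of two
   spaces on which [G] acts. *)
Definition system_conjugate (G : groupType) (T U : topologicalType)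
    (aT : G -> T -> T) (aU : G -> U -> U) (X : set T) (Y : set U) : Prop :=
  exists (f : T -> U) (h : U -> T),
    [/\ set_fun X Y f /\ set_fun Y X h,
        (forall x, X x -> h (f x) = x) /\ (forall y, Y y -> f (h y) = y),
        {within X, continuous f} /\ {within Y, continuous h}
      & forall g x, X x -> f (aT g x) = aU g (f x)].

Definition conjugate_to_prod (G : groupType) (Z X Y : set (config G)) : Prop :=
  @system_conjugate G (config G) (config G * config G)%type
    (@gshift G) (fun g z => (gshift g z.1, gshift g z.2)) Z (X `*` Y).

(* The disjoint union is realized in bool * nat^G, with bool discrete. *)
Definition disjoint_union (T : Type) (X Y : set T) : set (bool * T) :=
  [set z | if z.1 then X z.2 else Y z.2].

Definition conjugate_to_union (G : groupType) (Z X Y : set (config G)) : Prop :=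
  @system_conjugate G (config G) (bool * config G)%type
    (@gshift G) (fun g z => (z.1, gshift g z.2)) Z (disjoint_union X Y).

(** * Invariants *)

Section Invariants.
Variables (R : realType) (G : groupType) (n : nat) (S : n.-tuple G).

(* Only the values of [I] on G-SFTs matter. *)
Implicit Type I : set (config G) -> R.

Definition dynamical_invariant I : Prop :=
  forall X Y, is_sft S X -> is_sft S Y -> conjugate X Y -> I X = I Y.

Local Open Scope ring_scope.

Definition computable_from_presentations I : Prop :=
  exists f : rfun, forall (P : presentation n) (k : nat),
    exists2 q : rat, reval f [:: pickle P; k] (pickle q)
      & `|I (sft S P) - ratr q| <= 2 ^- k.

Definition nondecreasing_union I : Prop :=
  forall X Y Z, is_sft S X -> is_sft S Y -> is_sft S Z ->
    conjugate_to_union Z X Y -> I X <= I Z.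

Definition nondecreasing_prod I : Prop :=
  forall X Y Z, is_sft S X -> is_sft S Y -> is_sft S Z -> Y !=set0 ->
    conjugate_to_prod Z X Y -> I X <= I Z.

End Invariants.

(* Main.v *)
Require Import Defs.
From mathcomp Require Import all_boot all_order all_algebra.
From mathcomp Require Import all_classical all_reals all_analysis.
From mathcomp Require Import ring lra.

(** Only the comparisons with the empty subshift 0 and with one fixed subshift
    matter.  Since 0 + X is X, monotonicity under disjoint unions makes I(0) the
    least value of I.  Suppose that some SFT X, presented by P, has I(0) < I(X).
    For a presentation Q of an SFT Y, the product X * Y is empty when Y is, so
    that I(X * Y) = I(0), and otherwise I(X * Y) >= I(X) by monotonicity under
    products.  A presentation of X * Y can be computed from Q
    ([prod_presentation], [computable_prod_presentation]), hence so can a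
    rational approximation of I(X * Y), precise enough to be compared with a
    rational threshold strictly between I(0) and I(X)
    ([decidable_above_threshold]).  The outcome tells whether Y is empty, which
    decides the domino problem.

    Turning this into an actual mu-recursive expression requires a small
    calculus of computable functions between countable types, computability
    being measured on Goedel numbers ([computable]).  Its one substantial
    closure property is [computable_foldr]: list recursion is a primitive
    recursion over positions, and it yields maps, concatenations and thereby all
    the list manipulations of the product construction.  The numbering of lists
    is m :: s |-> 2 ^ m * (2 * code s + 1), so the head is the 2-adic valuation
    and the tail is obtained by shifting.

    The SFT X * Y lives on the alphabet of pairs of letters.  A forbidden
    pattern of one factor constrains a single coordinate, and is replaced with
    the finitely many patterns obtained by filling in the other coordinate in
    all possible ways ([lift]). *)

Set Implicit Arguments.
Unset Strict Implicit.
Unset Printing Implicit Defensive.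

Import Order.TTheory GRing.Theory Num.Theory.

Local Open Scope nat_scope.

(** * Evaluation of mu-recursive expressions *)

Lemma reval_comp1 f g v x z :
  reval g v x -> reval f [:: x] z -> reval (RComp f [:: g]) v z.
Proof.
by move=> gx fz; apply: reval_comp fz; apply: revals_cons gx (revals_nil v).
Qed.

Lemma reval_comp2 f g1 g2 v x1 x2 z :
  reval g1 v x1 -> reval g2 v x2 -> reval f [:: x1; x2] z ->
  reval (RComp f [:: g1; g2]) v z.
Proof.
move=> g1x g2x fz; apply: reval_comp fz.
by apply: revals_cons g1x (revals_cons g2x (revals_nil v)).
Qed.

(** The step is only required below [N]: on arguments that code nothing, the
    expressions to be iterated may diverge. *)
Lemma reval_rec f g v N (F : nat -> nat) :
  reval f v (F 0) ->
  (forall i, i < N -> reval g [:: i, F i & v] (F i.+1)) ->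
  reval (RRec f g) (N :: v) (F N).
Proof.
move=> f0 gS; elim: N gS => [|N IHN] gS; first exact: reval_rec0.
apply: reval_recS (gS N (ltnSn N)).
by apply: IHN => i ltiN; apply/gS/ltnW.
Qed.

Lemma reval_least f v (F : nat -> nat) N :
  (forall i, reval f (i :: v) (F i)) -> (forall i, i < N -> 0 < F i) ->
  F N = 0 -> reval (RMin f) v N.
Proof.
move=> fF F_gt0 FN; apply: reval_min => [i ltiN|]; last by rewrite -FN.
by exists (F i).-1; rewrite prednK ?F_gt0.
Qed.

(** * Arithmetic *)

Fixpoint rconst (k : nat) : rfun :=
  if k is k'.+1 then RComp RSucc [:: rconst k'] else RZero.

Lemma reval_const k v : reval (rconst k) v k.
Proof.
elim: k => [|k IHk] /=; first exact: reval_zero.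
exact: reval_comp1 IHk (reval_succ _).
Qed.

Definition radd := RRec (RProj 0) (RComp RSucc [:: RProj 1]).

Lemma reval_add m k : reval radd [:: m; k] (m + k).
Proof.
apply: (reval_rec (F := fun i => i + k)) => [|i _]; first exact: reval_proj.
exact: reval_comp1 (reval_proj _ _) (reval_succ _).
Qed.

Definition rpred := RRec RZero (RProj 0).

Lemma reval_pred m : reval rpred [:: m] m.-1.
Proof.
by apply: (reval_rec (F := predn)) => [|i _];
  [apply: reval_zero|apply: reval_proj].
Qed.

Definition rsub :=
  RComp (RRec (RProj 0) (RComp rpred [:: RProj 1])) [:: RProj 1; RProj 0].

Lemma reval_sub m k : reval rsub [:: m; k] (m - k).
Proof.
apply: reval_comp2 (reval_proj _ _) (reval_proj _ _) _.
apply: (reval_rec (F := fun i => m - i)) => [|i _].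
  by rewrite subn0; apply: reval_proj.
by rewrite subnS; apply: reval_comp1 (reval_proj _ _) (reval_pred _).
Qed.

Definition rmul := RRec RZero (RComp radd [:: RProj 2; RProj 1]).

Lemma reval_mul m k : reval rmul [:: m; k] (m * k).
Proof.
apply: (reval_rec (F := fun i => i * k)) => [|i _]; first exact: reval_zero.
rewrite mulSn.
exact: reval_comp2 (reval_proj _ _) (reval_proj _ _) (reval_add _ _).
Qed.

Definition rexp2 := RRec (rconst 1) (RComp radd [:: RProj 1; RProj 1]).

Lemma reval_exp2 m : reval rexp2 [:: m] (2 ^ m).
Proof.
apply: (reval_rec (F := expn 2)) => [|i _]; first exact: reval_const.
rewrite expnS mul2n -addnn.
exact: reval_comp2 (reval_proj _ _) (reval_proj _ _) (reval_add _ _).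
Qed.

(** [1 - odd i] is the parity of [i.+1]. *)
Definition rodd := RRec RZero (RComp rsub [:: rconst 1; RProj 1]).

Lemma reval_odd m : reval rodd [:: m] (odd m).
Proof.
apply: (reval_rec (F := fun i => odd i : nat)) => [|i _].
  exact: reval_zero.
apply: reval_comp2 (reval_const _ _) (reval_proj _ _) _ => /=.
rewrite (_ : nat_of_bool (~~ odd i) = 1 - odd i); last by case: (odd i).
exact: reval_sub.
Qed.

(** The halves of i and i.+1 add up to i. *)
Definition rhalf := RRec RZero (RComp rsub [:: RProj 0; RProj 1]).

Lemma reval_half m : reval rhalf [:: m] m./2.
Proof.
apply: (reval_rec (F := half)) => [|i _]; first exact: reval_zero.
apply: reval_comp2 (reval_proj _ _) (reval_proj _ _) _ => /=.
have -> : uphalf i = i - i./2.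
  rewrite -[in RHS](odd_double_half i) half_bit_double -addnn addnA addnK.
  exact: uphalf_half.
exact: reval_sub.
Qed.

(** * Codes of lists and pairs *)

Notation code := CodeSeq.code.

Lemma pickle_seqE (A : countType) (s : seq A) : pickle s = code (map pickle s).
Proof. by []. Qed.

Definition rcons_code :=
  RComp rmul [:: RComp rexp2 [:: RProj 0];
                 RComp RSucc [:: RComp radd [:: RProj 1; RProj 1]]].

Lemma reval_cons m s : reval rcons_code [:: m; code s] (code (m :: s)).
Proof.
apply: reval_comp2 (reval_mul _ _).
  exact: reval_comp1 (reval_proj _ _) (reval_exp2 _).
apply: reval_comp1 (reval_succ _) => /=; rewrite -addnn.
exact: reval_comp2 (reval_proj _ _) (reval_proj _ _) (reval_add _ _).
Qed.

Definition rshift := RRec (RProj 0) (RComp rhalf [:: RProj 1]).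

Lemma reval_shift i m : reval rshift [:: i; m] (m %/ 2 ^ i).
Proof.
apply: (reval_rec (F := fun i => m %/ 2 ^ i)) => [|j _].
  by rewrite divn1; apply: reval_proj.
rewrite expnSr divnMA divn2.
exact: reval_comp1 (reval_proj _ _) (reval_half _).
Qed.

Lemma code_cons_shift m s i :
  i <= m -> code (m :: s) %/ 2 ^ i = 2 ^ (m - i) * (code s).*2.+1.
Proof.
by move=> leim; rewrite /= -{1}(subnKC leim) expnD -mulnA mulKn ?expn_gt0.
Qed.

(** The tested quantity is (1 - odd (m / 2 ^ i)) * m.  For m > 0 its least zero
    is the 2-adic valuation of m; the factor m makes the search stop at once on
    the code 0 of the empty list. *)
Definition rhead :=
  RMin (RComp rmul
    [:: RComp rsub [:: rconst 1; RComp rodd [:: rshift]]; RProj 1]).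

Lemma reval_head s : reval rhead [:: code s] (head 0 s).
Proof.
apply: (reval_least (F := fun i => (1 - odd (code s %/ 2 ^ i)) * code s)).
- move=> i; apply: reval_comp2 (reval_proj _ _) (reval_mul _ _).
  apply: reval_comp2 (reval_const _ _) _ (reval_sub _ _).
  exact: reval_comp1 (reval_shift _ _) (reval_odd _).
- case: s => [|m s] // i /= ltim.
  rewrite muln_gt0 muln_gt0 expn_gt0 !andbT subn_gt0.
  rewrite -/(code (m :: s)) (code_cons_shift _ (ltnW ltim)).
  by rewrite oddM oddX -[_ == 0]negbK -lt0n subn_gt0 ltim.
- case: s => [|m s]; first by rewrite muln0.
  by rewrite code_cons_shift //= subnn mul1n /= odd_double.
Qed.

Definition rtail := RComp rhalf [:: RComp rshift [:: rhead; RProj 0]].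

Lemma reval_tail s : reval rtail [:: code s] (code (behead s)).
Proof.
apply: reval_comp1.
  exact: reval_comp2 (reval_head _) (reval_proj _ _) (reval_shift _ _).
case: s => [|m s]; first exact: reval_half.
rewrite code_cons_shift // subnn mul1n [behead _]/=.
rewrite -[X in reval _ _ X]uphalf_double.
exact: reval_half.
Qed.

Definition rdrop := RRec (RProj 0) (RComp rtail [:: RProj 1]).

Lemma reval_drop i s : reval rdrop [:: i; code s] (code (drop i s)).
Proof.
apply: (reval_rec (F := fun i => code (drop i s))) => [|j _].
  by rewrite drop0; apply: reval_proj.
have -> : drop j.+1 s = behead (drop j s) by rewrite -drop1 drop_drop add1n.
by apply: reval_comp1 (reval_tail _); apply: reval_proj.
Qed.

Definition rsize := RMin rdrop.

Lemma code_eq0 s : (code s == 0) = nilp s.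
Proof. by case: s => [|m s] //=; rewrite muln_eq0 expn_eq0. Qed.

Lemma reval_size s : reval rsize [:: code s] (size s).
Proof.
apply: (reval_least (F := fun i => code (drop i s))) => [i|i|].
- exact: reval_drop.
- by rewrite lt0n code_eq0 /nilp size_drop subn_eq0 -ltnNge.
- by rewrite drop_size.
Qed.

(** * Computable functions between countable types *)

(** Nothing is asked of the expression on numbers that are not codes.  It may
    diverge there, as the algorithm approximating an invariant does on numbers
    that code no presentation. *)
Definition computable (A B : countType) (f : A -> B) : Prop :=
  exists r, forall a, reval r [:: pickle a] (pickle (f a)).

Lemma eq_computable (A B : countType) (f g : A -> B) :
  f =1 g -> computable f -> computable g.
Proof. by move=> fg [r rf]; exists r => a; rewrite -fg. Qed.

Lemma computable_id (A : countType) : computable (@id A).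
Proof. by exists (RProj 0) => a; apply: reval_proj. Qed.

Lemma computable_const (A B : countType) (b : B) : computable (fun _ : A => b).
Proof. by exists (rconst (pickle b)) => a; apply: reval_const. Qed.

Lemma computable_comp (A B C : countType) (f : B -> C) (g : A -> B) :
  computable f -> computable g -> computable (fun a => f (g a)).
Proof.
by move=> [r rf] [q qg]; exists (RComp r [:: q]) => a; apply: reval_comp1.
Qed.

Lemma computable_binary (A B C D : countType) (op : B -> C -> D) r
    (f : A -> B) (g : A -> C) :
  (forall b c, reval r [:: pickle b; pickle c] (pickle (op b c))) ->
  computable f -> computable g -> computable (fun a => op (f a) (g a)).
Proof.
move=> rop [rf rfP] [rg rgP]; exists (RComp r [:: rf; rg]) => a.
exact: reval_comp2.
Qed.

Definition rpair := RComp rcons_code [:: RProj 0;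
  RComp rcons_code [:: RProj 1; RZero]].

Lemma reval_pair m k : reval rpair [:: m; k] (code [:: m; k]).
Proof.
apply: reval_comp2 (reval_proj _ _) _ (reval_cons _ _).
exact: reval_comp2 (reval_proj _ _) (reval_zero _) (reval_cons _ [::]).
Qed.

Lemma computable_pair (A B C : countType) (f : A -> B) (g : A -> C) :
  computable f -> computable g -> computable (fun a => (f a, g a)).
Proof. by apply: computable_binary => b c; apply: reval_pair. Qed.

Lemma computable_comp2 (A B C D : countType) (op : B -> C -> D)
    (f : A -> B) (g : A -> C) :
  computable (fun x : B * C => op x.1 x.2) -> computable f -> computable g ->
  computable (fun a => op (f a) (g a)).
Proof.
move=> opP fP gP; pose h a := (f a, g a).
by apply: (computable_comp opP (_ : computable h)); apply: computable_pair.
Qed.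

Lemma computable_fst (A B C : countType) (f : A -> B * C) :
  computable f -> computable (fun a => (f a).1).
Proof.
by apply: computable_comp; exists rhead => -[b c]; apply: reval_head.
Qed.

Lemma computable_snd (A B C : countType) (f : A -> B * C) :
  computable f -> computable (fun a => (f a).2).
Proof.
apply: computable_comp; exists (RComp rhead [:: rtail]) => -[b c].
exact: reval_comp1 (reval_tail [:: _; _]) (reval_head [:: _]).
Qed.

Lemma computable_cons (A B : countType) (f : A -> B) (s : A -> seq B) :
  computable f -> computable s -> computable (fun a => f a :: s a).
Proof. by apply: computable_binary => b t; apply: reval_cons. Qed.

(** The environment is [:: i; acc; z; a; N; s], where [N] is the length of [s]:
    step [i] combines [acc] with the entry of [s] at position N - i.+1. *)
Definition rfold r :=
  RRec (RProj 0) (RComp r [:: RComp rpair [:: RProj 3;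
    RComp rpair [:: RComp rhead [::
        RComp rdrop [:: RComp rsub [:: RProj 4; RComp RSucc [:: RProj 0]];
                        RProj 5]];
      RProj 1]]]).

(** After [i] steps the accumulator is the fold of the last [i] entries.  The
    number of steps is the length of the list, computed beforehand, so that the
    expression for [f] is only ever run on codes. *)
Lemma computable_foldr (A B C : countType) (f : A * (B * C) -> C)
    (s : A -> seq B) (z : A -> C) :
  computable f -> computable s -> computable z ->
  computable (fun a => foldr (fun b c => f (a, (b, c))) (z a) (s a)).
Proof.
move=> [rf rfP] [rs rsP] [rz rzP].
exists (RComp (rfold rf) [:: RComp rsize [:: rs]; rz; RProj 0;
                            RComp rsize [:: rs]; rs]) => a.
set N := size (s a).
have sizeN : reval (RComp rsize [:: rs]) [:: pickle a] N.
  apply: reval_comp1 (rsP a) _.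
  by rewrite /N -(size_map pickle (s a)); apply: reval_size.
apply: reval_comp.
  apply: (revals_cons sizeN); apply: revals_cons (rzP a) _.
  apply: revals_cons (reval_proj _ _) _; apply: (revals_cons sizeN).
  exact: revals_cons (rsP a) (revals_nil _).
pose F i := foldr (fun b c => f (a, (b, c))) (z a) (drop (N - i) (s a)).
rewrite (_ : foldr _ _ _ = F N); last by rewrite /F subnn drop0.
apply: (reval_rec (F := fun i => pickle (F i))) => [|i ltiN].
  by rewrite /F subn0 drop_size; apply: reval_proj.
have [b defb] : exists b, drop (N - i.+1) (s a) = b :: drop (N - i) (s a).
  have: N - i.+1 < size (s a) by rewrite ltn_subrL (leq_ltn_trans _ ltiN).
  case defs: (s a) => [|b0 s'] // ltNi; exists (nth b0 (s a) (N - i.+1)).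
  by rewrite -(subnSK ltiN) -defs -drop_nth // defs.
rewrite {2}/F defb /= -/(F i).
apply: reval_comp1 (rfP (a, (b, F i))).
apply: reval_comp2 (reval_proj _ _) _ (reval_pair _ _).
apply: reval_comp2 _ (reval_proj _ _) (reval_pair _ _).
have -> : pickle b = head 0 (drop (N - i.+1) (map pickle (s a))).
  by rewrite -map_drop defb.
apply: reval_comp1 _ (reval_head _).
apply: reval_comp2 (reval_drop _ _); last first.
  by rewrite -pickle_seqE; apply: reval_proj.
apply: reval_comp2 (reval_proj _ _) _ (reval_sub _ _).
exact: reval_comp1 (reval_proj _ _) (reval_succ _).
Qed.

Lemma computable_map (A B C : countType) (f : A * B -> C) (s : A -> seq B) :
  computable f -> computable s ->
  computable (fun a => [seq f (a, b) | b <- s a]).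
Proof.
move=> fP sP.
apply: (@computable_foldr _ _ _ (fun x => f (x.1, x.2.1) :: x.2.2) s
          (fun _ => [::])) => //; last exact: computable_const.
have idP := @computable_id (A * (B * seq C))%type.
apply: computable_cons; last exact/computable_snd/computable_snd.
apply: (computable_comp fP).
apply: computable_pair; first exact: computable_fst.
exact/computable_fst/computable_snd.
Qed.

Lemma computable_cat (A B : countType) (s t : A -> seq B) :
  computable s -> computable t -> computable (fun a => s a ++ t a).
Proof.
move=> sP tP.
apply: (@eq_computable _ _ (fun a => foldr cons (t a) (s a))).
  by move=> a; elim: (s a) => //= b u ->.
apply: (@computable_foldr _ _ _ (fun x => x.2.1 :: x.2.2)) => //.
have idP := @computable_id (A * (B * seq B))%type.
by apply: computable_cons; [apply: computable_fst|apply: computable_snd];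
  apply: computable_snd.
Qed.

Lemma computable_flatten (A B : countType) (ss : A -> seq (seq B)) :
  computable ss -> computable (fun a => flatten (ss a)).
Proof.
move=> ssP.
apply: (@computable_foldr _ _ _ (fun x => x.2.1 ++ x.2.2)) => //.
  have idP := @computable_id (A * (seq B * seq B))%type.
  by apply: computable_cat; [apply: computable_fst|apply: computable_snd];
    apply: computable_snd.
exact: computable_const.
Qed.

Lemma computable_add (A : countType) (f g : A -> nat) :
  computable f -> computable g -> computable (fun a => f a + g a).
Proof. exact: (@computable_binary A nat nat nat addn _ f g reval_add). Qed.

Lemma computable_sub (A : countType) (f g : A -> nat) :
  computable f -> computable g -> computable (fun a => f a - g a).
Proof. exact: (@computable_binary A nat nat nat subn _ f g reval_sub). Qed.

Lemma computable_mul (A : countType) (f g : A -> nat) :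
  computable f -> computable g -> computable (fun a => f a * g a).
Proof. exact: (@computable_binary A nat nat nat muln _ f g reval_mul). Qed.

Lemma computable_leq (A : countType) (f g : A -> nat) :
  computable f -> computable g -> computable (fun a => (f a <= g a) : nat).
Proof.
move=> fP gP; apply: (@eq_computable _ _ (fun a => 1 - (f a - g a))).
  by move=> a; rewrite /leq; case: (f a - g a).
by apply: computable_sub (computable_const _ _) _; apply: computable_sub.
Qed.

(** * Rational thresholds *)

(** An integer is coded by a pair of options, of which one is empty: its
    positive and negative parts are read off separately. *)

Definition int_pos (z : int) : nat := if z is Posz p then p else 0.
Definition int_neg (z : int) : nat := if z is Negz m then m.+1 else 0.

Lemma int_pos_negE (z : int) : z = (Posz (int_pos z) - Posz (int_neg z))%R.
Proof. by case: z => m /=; rewrite ?subr0 // NegzE sub0r. Qed.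

Lemma computable_int_pos : computable int_pos.
Proof.
exists (RComp rhead [:: rhead]) => -[p|m].
  exact: reval_comp1 (reval_head [:: code [:: p]; 0]) (reval_head [:: p]).
exact: reval_comp1 (reval_head [:: 0; code [:: m]]) (reval_head [::]).
Qed.

Lemma computable_int_neg : computable int_neg.
Proof.
pose r2 := RComp rhead [:: rtail].
exists (RComp rmul [:: RComp rsize [:: r2];
                       RComp RSucc [:: RComp rhead [:: r2]]]).
move=> z; pose s := if z is Negz m then [:: m] else [::].
have zs : reval r2 [:: pickle z] (code s).
  rewrite /s; case: z {s} => m.
    exact: reval_comp1 (reval_tail [:: code [:: m]; 0]) (reval_head [:: 0]).
  exact: reval_comp1 (reval_tail [:: 0; code [:: m]])
                     (reval_head [:: code [:: m]]).
have -> : pickle (int_neg z) = size s * (head 0 s).+1.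
  by rewrite /s; case: z {s zs} => // m; rewrite mul1n.
apply: reval_comp2 (reval_mul _ _); first exact: reval_comp1 zs (reval_size _).
exact: reval_comp1 (reval_comp1 zs (reval_head _)) (reval_succ _).
Qed.

(** Subtraction-free form of the comparison of fractions, suited to natural
    numbers. *)
Lemma rat_leE (q t : rat) : (q <= t)%R =
  (int_pos (numq q) * int_pos (denq t) + int_neg (numq t) * int_pos (denq q) <=
   int_pos (numq t) * int_pos (denq q) + int_neg (numq q) * int_pos (denq t)).
Proof.
have denE (r : rat) : denq r = Posz (int_pos (denq r)).
  by have := denq_gt0 r; case: (denq r).
have den_gt0 (r : rat) : (0 < (denq r)%:~R :> rat)%R by rewrite ltr0z denq_gt0.
have -> : (q <= t)%R = (numq q * denq t <= numq t * denq q)%R.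
  rewrite -{1}(divq_num_den q) -{1}(divq_num_den t) ler_pdivrMr // mulrAC.
  by rewrite ler_pdivlMr // -!intrM ler_int.
rewrite [in LHS](denE q) [in LHS](denE t).
rewrite [in LHS](int_pos_negE (numq q)) [in LHS](int_pos_negE (numq t)).
by rewrite !mulrBl lerBlDr addrAC lerBrDr -lez_nat !PoszD !PoszM.
Qed.

Lemma computable_rat_le (t : rat) :
  computable (fun q : rat => (q <= t)%R : nat).
Proof.
apply: eq_computable (fun q => congr1 nat_of_bool (esym (rat_leE q t))) _.
have qP : computable valq by exists (RProj 0) => q; apply: reval_proj.
have numP : computable numq by apply: computable_fst.
have denP : computable denq by apply: computable_snd.
have posP := computable_comp computable_int_pos numP.
have negP := computable_comp computable_int_neg numP.
have dP := computable_comp computable_int_pos denP.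
apply: computable_leq; apply: computable_add; apply: computable_mul => //;
  exact: computable_const.
Qed.

Local Open Scope classical_set_scope.

Section Threshold.
Local Open Scope ring_scope.

(** There is a gap between the values of [v] on and off [D]: approximating [v]
    within a third of the gap decides on which side of it a value lies. *)
Lemma decidable_above_threshold (R : realType) (A : countType) (v : A -> R)
    (a b : R) (D : set A) r : a < b ->
  (forall x k, exists2 q : rat, reval r [:: pickle x; k] (pickle q)
     & `|v x - ratr q| <= 2 ^- k) ->
  (forall x, D x -> v x <= a) -> (forall x, ~ D x -> b <= v x) ->
  exists d : A -> bool,
    computable (fun x => d x : nat) /\ forall x, d x <-> D x.
Proof.
move=> ltab rP va vb.
pose e := (b - a) / 3%:R.
have e_gt0 : 0 < e by rewrite divr_gt0 ?subr_gt0.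
have [k ke] : exists k, 2 ^- k < e.
  exists (Num.bound e^-1).
  by rewrite invf_plt ?posrE ?exprn_gt0 // upper_nthrootP.
have abE : b - e = a + e + e by rewrite /e; field.
(* An approximation of a value at most a lies below a + e, and one of a value
   at least b lies above b - e. *)
have [t /andP[]] : exists t, a + e < ratr t < b - e.
  have [|t] := @rat_in_itvoo R (a + e) (b - e); first by rewrite abE ltrDl.
  by rewrite in_itv /=; exists t.
move=> at_ tb.
have approx x : exists q : rat,
    reval r [:: pickle x; k] (pickle q) /\ `|v x - ratr q| <= 2 ^- k.
  by have [q qx vq] := rP x k; exists q.
have [q qP] := boolp.choice approx.
exists (fun x => q x <= t); split.
  apply: (computable_comp (computable_rat_le t)).
  exists (RComp r [:: RProj 0; rconst k]) => x.
  apply: reval_comp2 (qP x).1; [exact: reval_proj|exact: reval_const].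
move=> x; have := (qP x).2; rewrite ler_distl => /andP[vq qv].
rewrite -(ler_rat R); split=> [qt|/va vx].
  by apply: contrapT => /vb vx; lra.
lra.
Qed.

End Threshold.

(** * Product presentations *)

Section Lift.
Variables (n : nat) (pr : nat -> nat -> nat).

(** Forbidding [p] in one coordinate of a product, when the other coordinate has
    alphabet [B], amounts to forbidding all patterns of [lift B p]. *)
Definition lift (B : seq nat) (p : pattern n) : seq (pattern n) :=
  foldr (fun wa qs =>
           flatten [seq [seq (wa.1, pr b wa.2) :: q | q <- qs] | b <- B])
        [:: [::]] p.

Lemma unzip1_lift B p q : q \in lift B p -> unzip1 q = unzip1 p.
Proof.
elim: p q => [|wa p IHp] q /=; first by rewrite inE => /eqP ->.
by case/flatten_mapP => b _ /mapP[q' /IHp /= <- ->].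
Qed.

Lemma letters_lift B p q c : q \in lift B p -> c \in unzip2 q ->
  exists b a, [/\ b \in B, a \in unzip2 p & c = pr b a].
Proof.
elim: p q => [|wa p IHp] q /=; first by rewrite inE => /eqP ->.
case/flatten_mapP => b bB /mapP[q' q'p ->] /=; rewrite inE => /predU1P[->|cq'].
  by exists b, wa.2; rewrite mem_head.
have [b' [a [b'B ap ->]]] := IHp _ q'p cq'.
by exists b', a; rewrite inE ap orbT.
Qed.

Lemma computable_lift (A : countType) (B : A -> seq nat) (p : A -> pattern n) :
  computable (fun ba : nat * nat => pr ba.1 ba.2) ->
  computable B -> computable p -> computable (fun a => lift (B a) (p a)).
Proof.
move=> prP BP pP.
pose P := (seq 'I_n * nat)%type.
apply: (@computable_foldr A P (seq (seq P)) (fun x => flatten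
    [seq [seq (x.2.1.1, pr b x.2.1.2) :: q | q <- x.2.2] | b <- B x.1])) => //;
  last exact: computable_const.
apply: computable_flatten.
pose T := (A * (P * seq (seq P)))%type.
have idP := @computable_id T.
apply: (@computable_map T nat _ (fun y =>
  [seq (y.1.2.1.1, pr y.2 y.1.2.1.2) :: q | q <- y.1.2.2])); last first.
  by apply: computable_comp BP _; apply: computable_fst.
have idP' := @computable_id (T * nat)%type.
apply: (@computable_map (T * nat)%type (seq P) _ (fun y =>
  (y.1.1.2.1.1, pr y.1.2 y.1.1.2.1.2) :: y.2)); last first.
  by do 2!apply: computable_snd; apply: computable_fst.
have idP'' := @computable_id (T * nat * seq P)%type.
apply: computable_cons; last exact: computable_snd.
have h21 : computable (fun y : T * nat * seq P => y.1.1.2.1).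
  by apply: computable_fst; apply: computable_snd; do 2!apply: computable_fst.
apply: computable_pair; first exact: computable_fst.
apply: (computable_comp2 prP); last exact: computable_snd.
by apply: computable_snd; apply: computable_fst.
Qed.

Variables (G : groupType) (S : n.-tuple G).

Lemma appears_cons (w : seq 'I_n) a p (x : config G) g :
  appears S ((w, a) :: p) x g <-> x (g * word_elt S w)%g = a /\ appears S p x g.
Proof.
split=> [xp|[xw xp] w' a']; last by rewrite inE => /predU1P[[-> ->]|/xp].
by split=> [|w' a' w'p]; apply: xp; rewrite ?mem_head // inE w'p orbT.
Qed.

Lemma appears_lift B p (x y : config G) g :
  (forall h, exists2 b, b \in B & x h = pr b (y h)) ->
  appears S p y g -> exists2 q, q \in lift B p & appears S q x g.
Proof.
move=> xy; elim: p => [|[w a] p IHp]; first by exists [::]; rewrite ?mem_head.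
case/appears_cons => yw /IHp[q qp xq].
have [b bB xw] := xy (g * word_elt S w)%g.
exists ((w, pr b a) :: q); last by apply/appears_cons; rewrite xw yw.
by apply/flatten_mapP; exists b => //; apply: map_f.
Qed.

Lemma lift_appears k B p q (x : config G) g : (forall b a, k (pr b a) = a) ->
  q \in lift B p -> appears S q x g -> appears S p (fun h => k (x h)) g.
Proof.
move=> prK; elim: p q => [|[w a] p IHp] q //=.
case/flatten_mapP => b _ /mapP[q' q'p ->] /appears_cons[xw xq'].
by apply/appears_cons; rewrite xw prK; split=> //; apply: IHp xq'.
Qed.

End Lift.

(** The letter coding a pair is the Goedel number of the pair, so that pairing
    letters costs nothing to compute. *)
Definition pair_letter (b a : nat) : nat := pickle (b, a).
Definition pair_letterC (a b : nat) : nat := pickle (b, a).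
Definition letter1 (c : nat) : nat := (odflt (0, 0) (unpickle c)).1.
Definition letter2 (c : nat) : nat := (odflt (0, 0) (unpickle c)).2.

Lemma pair_letterK1 b a : letter1 (pair_letter b a) = b.
Proof. by rewrite /letter1 pickleK. Qed.

Lemma pair_letterK2 b a : letter2 (pair_letter b a) = a.
Proof. by rewrite /letter2 pickleK. Qed.

Section Product.
Variables (n : nat) (P Q : presentation n).

Definition prod_alphabet : seq nat :=
  flatten [seq [seq pair_letter b a | a <- alphabet Q] | b <- alphabet P].

Definition prod_forbidden : seq (pattern n) :=
  flatten [seq lift pair_letter (alphabet P) q | q <- forbidden Q] ++
  flatten [seq lift pair_letterC (alphabet Q) p | p <- forbidden P].

Lemma prod_alphabetP c :
  reflect (exists b a, [/\ b \in alphabet P, a \in alphabet Q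
                        & c = pair_letter b a])
          (c \in prod_alphabet).
Proof.
apply: (iffP flatten_mapP) => [[b bP /mapP[a aQ ->]]|[b [a [bP aQ ->]]]].
  by exists b, a.
by exists b => //; apply: map_f.
Qed.

Lemma prod_is_pattern : all (is_pattern prod_alphabet) prod_forbidden.
Proof.
have pP (R : presentation n) p : p \in forbidden R -> is_pattern (alphabet R) p.
  by case: R => D DP; apply: (allP DP).
apply/allP => q.
rewrite mem_cat => /orP[] /flatten_mapP[p /pP/andP[up /allP Ap] qp];
  apply/andP; split; rewrite ?(unzip1_lift qp) //.
- apply/allP => c /(letters_lift qp)[b [a [bP /Ap aQ ->]]].
  by apply/prod_alphabetP; exists b, a.
- apply/allP => c /(letters_lift qp)[a [b [aQ /Ap bP ->]]].
  by apply/prod_alphabetP; exists b, a.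
Qed.

Definition prod_presentation : presentation n :=
  @Presentation n (prod_alphabet, prod_forbidden) prod_is_pattern.

Variables (G : groupType) (S : n.-tuple G).

Definition zip_config (x y : config G) : config G :=
  fun g => pair_letter (x g) (y g).
Definition config1 (z : config G) : config G := fun g => letter1 (z g).
Definition config2 (z : config G) : config G := fun g => letter2 (z g).

(** A forbidden pattern of a factor appears in the corresponding coordinate of
    [z] exactly when one of its lifts appears in [z], because the letters of the
    other coordinate belong to the alphabet used for lifting. *)
Lemma sft_prodP (z : config G) : sft S prod_presentation z ->
  [/\ sft S P (config1 z), sft S Q (config2 z)
    & z = zip_config (config1 z) (config2 z)].
Proof.
move=> [zA zF].
have zE g : [/\ letter1 (z g) \in alphabet P, letter2 (z g) \in alphabet Q
              & z g = pair_letter (letter1 (z g)) (letter2 (z g))].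
  have /prod_alphabetP[b [a [bP aQ ->]]] := zA g.
  by rewrite pair_letterK1 pair_letterK2.
split; last by apply/funext => g; have [] := zE g.
- split=> [g|p pF g pz]; first by have [] := zE g.
  have [|q qp zq] := @appears_lift n pair_letterC G S (alphabet Q) p z _ g _ pz.
    by move=> h; exists (letter2 (z h)); have [] := zE h.
  apply: zF zq; rewrite mem_cat; apply/orP; right.
  by apply/flatten_mapP; exists p.
- split=> [g|p pF g pz]; first by have [] := zE g.
  have [|q qp zq] := @appears_lift n pair_letter G S (alphabet P) p z _ g _ pz.
    by move=> h; exists (letter1 (z h)); have [] := zE h.
  apply: zF zq; rewrite mem_cat; apply/orP; left.
  by apply/flatten_mapP; exists p.
Qed.

Lemma zip_configK x y :
  (config1 (zip_config x y) = x) * (config2 (zip_config x y) = y).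
Proof.
by split; apply/funext => g;
  rewrite /config1 /config2 ?pair_letterK1 ?pair_letterK2.
Qed.

Lemma sft_zip x y :
  sft S P x -> sft S Q y -> sft S prod_presentation (zip_config x y).
Proof.
move=> [xP xF] [yQ yF]; split=> [g|q].
  by apply/prod_alphabetP; exists (x g), (y g).
rewrite mem_cat => /orP[] /flatten_mapP[p pF qp] g zq.
- apply: (yF p pF g); rewrite -[y](zip_configK x y).2.
  exact: lift_appears pair_letterK2 qp zq.
- apply: (xF p pF g); rewrite -[x](zip_configK x y).1.
  by apply: lift_appears qp zq => a b; apply: pair_letterK1.
Qed.

End Product.

Lemma computable_prod_presentation n (P : presentation n) :
  computable (prod_presentation P).
Proof.
have prP : computable (fun ba : nat * nat => pair_letter ba.1 ba.2).
  by exists (RProj 0) => -[b a]; apply: reval_proj.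
have prCP : computable (fun ba : nat * nat => pair_letterC ba.1 ba.2).
  apply: (@computable_pair (nat * nat)%type nat nat
            (fun ba => ba.2) (fun ba => ba.1)).
    exact/computable_snd/computable_id.
  exact/computable_fst/computable_id.
have dP : computable (@pres_data n) by exists (RProj 0) => Q; apply: reval_proj.
have aP : computable (@alphabet n) by apply: computable_fst.
have fP : computable (@forbidden n) by apply: computable_snd.
suff [r rP] : computable (fun Q => (prod_alphabet P Q, prod_forbidden P Q)).
  by exists r.
apply: computable_pair.
  apply: computable_flatten.
  apply: (@computable_map _ _ _ (fun Qb =>
    [seq pair_letter Qb.2 a | a <- alphabet Qb.1]));
    last exact: computable_const.
  have idP := @computable_id (presentation n * nat)%type.
  apply: (@computable_map _ _ _ (fun Qba => pair_letter Qba.1.2 Qba.2)).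
    have idP' := @computable_id (presentation n * nat * nat)%type.
    apply: (computable_comp2 prP); last exact: computable_snd.
    exact/computable_snd/computable_fst.
  by apply: computable_comp aP _; apply: computable_fst.
have idP := @computable_id (presentation n * pattern n)%type.
apply: computable_cat; apply: computable_flatten.
  apply: (@computable_map _ _ _ (fun Qq =>
    lift pair_letter (alphabet P) Qq.2)) => //.
  apply: computable_lift => //; first exact: computable_const.
  exact: computable_snd.
apply: (@computable_map _ _ _ (fun Qp =>
  lift pair_letterC (alphabet Qp.1) Qp.2)) => //;
  last exact: computable_const.
apply: computable_lift => //; last exact: computable_snd.
by apply: computable_comp aP _; apply: computable_fst.
Qed.

(** * Conjugacies *)

Lemma continuous_config (T : topologicalType) (G : groupType)
    (f : T -> config G) :
  (forall g, continuous (fun t => f t g)) -> continuous f.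
Proof.
move=> f_cont t; apply/cvg_sup => g U [V [[W oW <-] Wft WU]].
apply: filterS WU _; apply: (f_cont g t).
by apply: open_nbhs_nbhs; split.
Qed.

(** The map only depends on one coordinate, and that coordinate is discrete. *)
Lemma continuous_letter (G : groupType) (k : nat -> nat) (g : G) :
  continuous (fun x : config G => k (x g)).
Proof.
move=> x; apply: (@continuous_comp (config G) nat nat (fun x => x g) k).
  exact: (@proj_continuous G (fun _ => nat) g x).
move=> B /nbhs_singleton Bk; apply: filterS (discrete_set1 _) => _ ->.
exact: Bk.
Qed.

Lemma prod_presentationP (n : nat) (P Q : presentation n) (G : groupType)
    (S : n.-tuple G) :
  conjugate_to_prod (sft S (prod_presentation P Q)) (sft S P) (sft S Q).
Proof.
exists (fun z => (config1 z, config2 z)), (fun xy => zip_config xy.1 xy.2).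
split.
- by split=> [z /sft_prodP[]|[x y] [] /=]; last exact: sft_zip.
- by split=> [z /sft_prodP[]|[x y] _] //=; rewrite !zip_configK.
- split; apply: continuous_subspaceT.
    move=> z; apply: (@cvg_pair _ _ _ _ (nbhs (config1 z)) (nbhs (config2 z)));
      apply: continuous_config => g; apply: continuous_letter.
  apply: continuous_config => g xy B /nbhs_singleton Bxy.
  have near1 : nbhs xy.1 [set x : config G | x g = xy.1 g].
    exact: (@continuous_letter G id g xy.1 _ (discrete_set1 (xy.1 g))).
  have near2 : nbhs xy.2 [set x : config G | x g = xy.2 g].
    exact: (@continuous_letter G id g xy.2 _ (discrete_set1 (xy.2 g))).
  exists ([set x : config G | x g = xy.1 g], [set y : config G | y g = xy.2 g]).
    by split.
  by move=> [x y] [/= x1 y2]; rewrite /zip_config /= x1 y2.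
- by [].
Qed.

Definition empty_presentation n : presentation n :=
  @Presentation n ([::], [::]) isT.

Lemma sft_empty n (G : groupType) (S : n.-tuple G) :
  sft S (empty_presentation n) = set0.
Proof. by rewrite -subset0 => x [/(_ 1%g)]. Qed.

Lemma conjugate_to_union0 (G : groupType) (X : set (config G)) :
  conjugate_to_union X set0 X.
Proof.
exists (fun x => (false, x)), snd; split=> //.
- by split=> [x|[[] x]].
- by split=> [x|[[] x]].
- split; apply: continuous_subspaceT => z.
    by apply: (@cvg_pair _ _ _ _ (nbhs false) (nbhs z));
      [apply: cvg_cst|apply: cvg_id].
  exact: cvg_snd.
Qed.

(** * Constancy of the invariant *)

Theorem theorem4p1 (R : realType) (G : groupType) (n : nat) (S : n.-tuple G)
    (hS : symmetric_generating_set S)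
    (hDP : ~ domino_decidable S)
    (I : set (config G) -> R)
    (I_inv : dynamical_invariant S I)
    (I_comp : computable_from_presentations S I)
    (I_union : nondecreasing_union S I)
    (I_prod : nondecreasing_prod S I) :
  forall X Y : set (config G), is_sft S X -> is_sft S Y -> I X = I Y.
Proof.
have sft0 : is_sft S set0 by exists (empty_presentation n); rewrite sft_empty.
suff I0 X : is_sft S X -> I X = I set0.
  by move=> X Y sftX sftY; rewrite (I0 X) ?(I0 Y).
move=> sftX; have := I_union _ _ _ sft0 sftX sftX (conjugate_to_union0 X).
rewrite le_eqVlt => /orP[/eqP //|lt0X]; case: hDP.
case: sftX lt0X => P -> lt0P {X}.
pose Z Q := prod_presentation P Q.
have [f fP] := I_comp; have [rZ rZP] := computable_prod_presentation P.
have approx Q k : exists2 q : rat,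
    reval (RComp f [:: RComp rZ [:: RProj 0]; RProj 1])
      [:: pickle Q; k] (pickle q)
    & (`|I (sft S (Z Q)) - ratr q| <= 2 ^- k)%R.
  have [q fq vq] := fP (Z Q) k; exists q => //.
  apply: reval_comp2 fq; last exact: reval_proj.
  by apply: reval_comp1 (rZP Q); apply: reval_proj.
have below Q : domino_problem S Q -> (I (sft S (Z Q)) <= I set0)%R.
  move=> DQ; suff -> : sft S (Z Q) = set0 by [].
  by rewrite -subset0 => z /sft_prodP[_]; rewrite DQ.
have above Q : ~ domino_problem S Q -> (I (sft S P) <= I (sft S (Z Q)))%R.
  move=> /eqP/set0P Q0; have sftI R' : is_sft S (sft S R') by exists R'.
  exact: (I_prod _ _ _ _ _ _ Q0 (prod_presentationP P Q S)).
have [d [[r rP] dP]] := decidable_above_threshold lt0P approx below above.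
exists r => Q; have := rP Q; case: (d Q) (dP Q) => -[dD Dd] rQ; split=> DQ //.
  by case: DQ; apply: dD.
by have := Dd DQ.
Qed.
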